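(* Let $x_1,x_2,\ldots,y_1,y_2,\ldots$ be indeterminates. For every integer $n\ge 1$, the identity $$\sum_{k=1}^{n}\frac{y_k}{x_k}=\cfrac{a_1}{b_1+\cfrac{a_2}{b_2+\cdots+\cfrac{a_{2n}}{b_{2n}}}}$$ holds in the field of rational functions over $\mathbb{Q}$ in these indeterminates, where $a_1=y_1$, $b_1=x_1-y_1$, and for $k\ge 1$ $$a_{2k}=\theta y_{k-1},\quad a_{2k+1}=\theta^2 y_{k-1},\quad b_{2k}=x_{k-1},\quad b_{2k+1}=\frac{\theta^2x_{k-1}-\theta^2y_{k-1}}{x_{k-1}}.$$
   Context: For a sequence $(u_k)_{k\ge 1}$ of indeterminates, set $u_0=1$ (so $x_0=y_0=1$) and define, for $k\ge 0$, $\theta u_k=\dfrac{u_{k+1}}{u_k}$ and $\theta^2u_k=\theta(\theta u_k)=\dfrac{u_{k+2}u_k}{u_{k+1}^2}$. *)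

(* Defs.v *)
From HB Require Import structures.
From mathcomp Require Import all_boot all_algebra.
From mathcomp Require Import finmap monalg.

Set Implicit Arguments.
Unset Strict Implicit.
Unset Printing Implicit Defensive.

Import GRing.Theory.
Local Open Scope ring_scope.

(* {malg R[{cmonom I}]} is the polynomial ring over R in the indeterminates
   indexed by I. The library only makes it a commutative ring; for a countable
   I and an integral domain R we make it an integral domain, by Kronecker's
   substitution of 'X^(b ^ i) for the i-th indeterminate, b being larger than
   every exponent involved. *)
Section PolynomialIdomain.
Variables (I : countType) (R : idomainType).
Implicit Types (m : cmonom I) (p q : {malg R[{cmonom I}]}).

Lemma digits_inj b N (f g : nat -> nat) :
  (forall j, f j < b)%N -> (forall j, g j < b)%N ->
  (\sum_(j < N) f j * b ^ j = \sum_(j < N) g j * b ^ j)%N ->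
  forall j, (j < N)%N -> f j = g j.
Proof.
move=> fb gb; elim: N f g fb gb => // N IH f g fb gb.
have b_gt0 : (0 < b)%N by apply: leq_ltn_trans (fb 0%N).
have E (h : nat -> nat) : (\sum_(j < N.+1) h j * b ^ j =
            (\sum_(j < N) h j.+1 * b ^ j) * b + h 0)%N.
  rewrite big_ord_recl expn0 muln1 addnC big_distrl /=; congr (_ + _)%N.
  by apply: eq_bigr => j _; rewrite /bump /= add1n expnSr mulnA.
rewrite !E => eqfg.
have e0 : f 0%N = g 0%N.
  by have := congr1 (modn^~ b) eqfg; rewrite !modnMDl !modn_small.
have eS : (\sum_(j < N) f j.+1 * b ^ j = \sum_(j < N) g j.+1 * b ^ j)%N.
  by have := congr1 (divn^~ b) eqfg; rewrite !divnMDl // !divn_small // !addn0.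
by case=> // j ltjN; apply: (IH (f \o succn) (g \o succn)) => // k /=.
Qed.

Definition kdigit m (j : nat) : nat :=
  if pickle_inv j is Some i then m i else 0.

Definition kweight (B : nat) m : nat :=
  (\sum_(j < B.+1) kdigit m j * B.+1 ^ j)%N.

Definition kbounded (B : nat) m :=
  forall i : I, (m i <= B)%N /\ (0 < m i -> choice.pickle i <= B)%N.

Lemma kdigit_lt B m j : kbounded B m -> (kdigit m j < B.+1)%N.
Proof. by move=> mB; rewrite /kdigit; case: pickle_inv => // i; have [] := mB i. Qed.

Lemma kweight_inj B m1 m2 : kbounded B m1 -> kbounded B m2 ->
  kweight B m1 = kweight B m2 -> m1 = m2.
Proof.
move=> m1B m2B eqw; apply/eqP/cmP => i.
have dE m : m i = kdigit m (choice.pickle i) by rewrite /kdigit pickleK_inv.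
have [le_iB|lt_Bi] := leqP (choice.pickle i) B.
  rewrite !dE; apply: (digits_inj _ _ eqw) => // j; exact: kdigit_lt.
have z m : kbounded B m -> m i = 0%N.
  by case/(_ i) => _; case: posnP => // _ /(_ isT); rewrite leqNgt lt_Bi.
by rewrite !z.
Qed.

Lemma kweight1 B : kweight B mone = 0%N.
Proof.
by apply: big1 => j _; rewrite /kdigit; case: pickle_inv => // i; rewrite cm1.
Qed.

Lemma kweightM B m1 m2 : kweight B (mmul m1 m2) = (kweight B m1 + kweight B m2)%N.
Proof.
rewrite /kweight -big_split; apply: eq_bigr => j _ /=; rewrite -mulnDl.
by congr (_ * _)%N; rewrite /kdigit; case: pickle_inv => // i; rewrite cmM.
Qed.

Lemma kbounded1 B : kbounded B mone.
Proof. by move=> i; rewrite cm1. Qed.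

Lemma kbounded_ex (s : seq (cmonom I)) :
  exists B, forall m, m \in s -> kbounded B m.
Proof.
elim: s => [|m s [B sB]]; first by exists 0%N.
pose C := (\sum_(i <- finsupp m) (m i + choice.pickle i))%N.
have mC i : (0 < m i -> m i + choice.pickle i <= C)%N.
  by rewrite lt0n cmE_neq0 => mi; rewrite /C (big_fsetD1 i) //= leq_addr.
exists (B + C)%N => m1; rewrite inE => /predU1P[-> i|/sB m1B i].
  have [->//|mi] := posnP (m i).
  have le := leq_trans (mC i mi) (leq_addl B C).
  by split=> [|_]; apply: leq_trans le; rewrite ?leq_addr ?leq_addl.
have [h1 h2] := m1B i; split=> [|/h2 h]; exact: leq_trans (leq_addr _ _).
Qed.

Definition kmonom (B : nat) m : {poly R} := 'X^(kweight B m).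

Lemma kmonom_mmorphism B : mmorphism (kmonom B).
Proof.
split=> [m1 m2|]; first by rewrite /kmonom kweightM exprD.
by rewrite /kmonom kweight1 expr0.
Qed.

HB.instance Definition _ B :=
  isMultiplicative.Build (cmonom I) {poly R} (kmonom B) (kmonom_mmorphism B).

Definition kronecker (B : nat) p : {poly R} := mmap polyC (kmonom B) p.

Lemma kroneckerM B p q : kronecker B (p * q) = kronecker B p * kronecker B q.
Proof. exact: rmorphM. Qed.

Lemma kronecker1 B : kronecker B 1 = 1.
Proof. exact: rmorph1. Qed.

Lemma coef_kronecker B p m : kbounded B m ->
  (forall m1, m1 \in msupp p -> kbounded B m1) ->
  (kronecker B p)`_(kweight B m) = p@_m.
Proof.
move=> mB pB; rewrite /kronecker mmapE coef_sum.
under eq_bigr => k _ do rewrite coefCM coefXn.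
case: (msuppP p m) => [mp|mNp].
  rewrite (big_fsetD1 m) //= eqxx mulr1 big_seq big1 ?addr0 // => k.
  rewrite in_fsetD1 => /andP[nkm kp]; case: eqP => [/kweight_inj|]; last by rewrite mulr0.
  by move=> e; case/eqP: nkm; rewrite e //; apply: pB.
rewrite big_seq big1 // => k kp; case: eqP => [/kweight_inj e|]; last by rewrite mulr0.
by case/negP: mNp; rewrite e //; apply: pB.
Qed.

Lemma kronecker_eq0 B p : (forall m, m \in msupp p -> kbounded B m) ->
  kronecker B p = 0 -> p = 0.
Proof.
move=> pB p0; apply/malgP => m; rewrite mcoeff0.
case: (msuppP p m) => // mp.
by rewrite -(coef_kronecker (pB m mp) pB) p0 coef0.
Qed.

Lemma malg_idomainAxiom p q : p * q = 0 -> (p == 0) || (q == 0).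
Proof.
have [B sB] := kbounded_ex (msupp p ++ msupp q).
move/(congr1 (kronecker B)); rewrite kroneckerM {3}/kronecker mmap0.
move=> /eqP; rewrite mulf_eq0 => /orP[] /eqP /kronecker_eq0 -> //.
- by rewrite eqxx.
- by move=> m mp; apply: sB; rewrite mem_cat mp.
- by rewrite eqxx orbT.
- by move=> m mq; apply: sB; rewrite mem_cat mq orbT.
Qed.

Definition malg_unit : pred {malg R[{cmonom I}]} :=
  fun p => (p == (p@_mone)%:MP) && (p@_mone \in GRing.unit).

Definition malg_inv p := if malg_unit p then (p@_mone)^-1%:MP else p.

Lemma malg_mulVp : {in malg_unit, left_inverse 1 malg_inv *%R}.
Proof.
move=> p Up; rewrite /malg_inv ifT //; case/andP: Up => /eqP Ep Up.
rewrite [X in _ * X]Ep -[LHS](@mpolyCM (cmonom I) R) (mulVr Up).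
exact: mpolyC1E.
Qed.

Lemma malg_intro_unit p q : q * p = 1 -> malg_unit p.
Proof.
move=> qp1; apply/andP; split; last first.
  apply/unitrPr; exists q@_mone; rewrite mulrC.
  by have := congr1 (mcoeff mone) qp1; rewrite rmorphM rmorph1.
have [B sB] := kbounded_ex (msupp p).
have : kronecker B p \in GRing.unit.
  apply/unitrPr; exists (kronecker B q).
  by rewrite mulrC -kroneckerM qp1 kronecker1.
rewrite poly_unitE => /andP[/eqP szp _].
apply/eqP/malgP => m; rewrite mcoeffC.
have [<-|n1m] := eqVneq; first by rewrite mulr1n.
rewrite mulr0n; case: (msuppP p m) => // mp; have mB := sB m mp.
rewrite -(coef_kronecker mB sB) nth_default // szp lt0n.
apply: contraNN n1m => /eqP w0; apply/eqP.
by apply: (kweight_inj mB (@kbounded1 B)); rewrite kweight1.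
Qed.

Lemma malg_inv_out : {in [predC malg_unit], malg_inv =1 id}.
Proof. by move=> p /negbTE /= Up; rewrite /malg_inv ifF. Qed.

HB.instance Definition _ := GRing.ComRing_hasMulInverse.Build
  (malg (cmonom I) R) malg_mulVp malg_intro_unit malg_inv_out.
HB.instance Definition _ := GRing.ComUnitRing.on {malg R[{cmonom I}]}.
HB.instance Definition _ := GRing.ComUnitRing_isIntegral.Build
  (malg (cmonom I) R) malg_idomainAxiom.
HB.instance Definition _ := GRing.IntegralDomain.on {malg R[{cmonom I}]}.

End PolynomialIdomain.

Definition ratfun := {fraction {malg rat[{cmonom (nat + nat)%type}]}}.

Definition indet (i : (nat + nat)%type) : ratfun := tofrac << ucm i >>.

(* The indeterminate x_(k+1) is indexed by inl k and y_(k+1) by inr k;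
   x_0 = y_0 = 1. *)
Definition x (k : nat) : ratfun := if k is j.+1 then indet (inl j) else 1.
Definition y (k : nat) : ratfun := if k is j.+1 then indet (inr j) else 1.

Definition theta (F : fieldType) (u : nat -> F) (k : nat) : F :=
  u k.+1 / u k.

Definition theta2 (F : fieldType) (u : nat -> F) : nat -> F :=
  theta (theta u).

(* a_j / (b_j + a_(j+1) / (b_(j+1) + ... + a_(j+m-1) / b_(j+m-1))),
   with m partial quotients; it is 0 for m = 0. *)
Fixpoint cfrac (F : fieldType) (a b : nat -> F) (j m : nat) : F :=
  if m is m'.+1 then a j / (b j + cfrac a b j.+1 m') else 0.

(* As z / 0 = 0 in a fieldType, that the continued fraction makes sense, i.e.
   that none of its denominators vanishes, has to be said separately. *)
Fixpoint cfrac_defined (F : fieldType) (a b : nat -> F) (j m : nat) : Prop :=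
  if m is m'.+1 then
    b j + cfrac a b j.+1 m' != 0 /\ cfrac_defined a b j.+1 m'
  else True.

(* Main.v *)
(* Put r_k = y_k / x_k, S_k = r_k + ... + r_n and
   D_k = r_(k+1) S_(k+1) - r_k S_(k+2). By descending induction on k, the tail of
   the continued fraction starting at a_(2k+2) is
   x_(k+1) D_k / (x_k y_k S_(k+1)), with denominators
     b_(2k+3) + ... = y_(k+2) D_k / (y_(k+1)^2 S_(k+2)),
     b_(2k+2) + ... = x_k r_(k+1) S_(k+1) / D_k.
   No S_k or D_k vanishes: setting all the indeterminates to 1 sends S_k to
   n + 1 - k and D_k to 1. *)
Require Import Defs.
From HB Require Import structures.
From mathcomp Require Import all_boot all_algebra.
From mathcomp Require Import finmap monalg ring.

Set Implicit Arguments.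
Unset Strict Implicit.
Unset Printing Implicit Defensive.

Import GRing.Theory.
Local Open Scope ring_scope.

(** * Closed forms for the tails of the continued fraction *)

Section CfracTails.
Variables (F : fieldType) (x y : nat -> F) (a b : nat -> F) (n : nat).
Hypotheses (x_neq0 : forall k, x k != 0) (y_neq0 : forall k, y k != 0).
Hypothesis a_even : forall k, a k.*2.+2 = theta y k.
Hypothesis a_odd : forall k, a k.*2.+3 = theta2 y k.
Hypothesis b_even : forall k, b k.*2.+2 = x k.
Hypothesis b_odd : forall k, b k.*2.+3 = (theta2 x k - theta2 y k) / x k.

Let r k := y k / x k.
Let S k := \sum_(k <= j < n.+1) r j.
Let D k := r k.+1 * S k.+1 - r k * S k.+2.

Hypothesis S_neq0 : forall k, (k < n)%N -> S k.+1 != 0.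
Hypothesis D_neq0 : forall k, (k < n)%N -> D k != 0.

(** Induction on [m = n - k - 1] realizes the descending induction on k. The [m.*2.+1] partial
    quotients from index 2k + 2 on end exactly at index 2n. *)
Lemma cfrac_even_tail m k : (k + m.+1)%N = n ->
  cfrac_defined a b k.*2.+2 m.*2.+1 /\
  cfrac a b k.*2.+2 m.*2.+1 = x k.+1 * D k / (x k * y k * S k.+1).
Proof.
have SE j : (j <= n)%N -> S j = r j + S j.+1.
  by move=> le_jn; rewrite /S big_ltn.
elim: m k => [|m IHm] k kE.
  have lt_kn : (k < n)%N by rewrite -kE addn1.
  have S0 : S k.+2 = 0 by rewrite /S big_geq // -kE addn1.
  rewrite /cfrac_defined /cfrac addr0 a_even b_even x_neq0; split=> //.
  rewrite /D SE // S0 !addr0 mulr0 subr0 /theta /r.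
  by field; rewrite !x_neq0 !y_neq0.
have lt_kn : (k < n)%N by rewrite -kE -addSnnS leq_addr.
have lt_k1n : (k.+1 < n)%N by rewrite -kE -!addSnnS leq_addr.
have [|def_tail tailE] := IHm k.+1; first by rewrite -kE addSnnS.
have Sk := S_neq0 lt_kn; have Sk1 := S_neq0 lt_k1n.
have Dk := D_neq0 lt_kn.
have oddE : b k.*2.+3 + cfrac a b k.+1.*2.+2 m.*2.+1 =
    y k.+2 * D k / (y k.+1 ^+ 2 * S k.+2).
  (* Every sum is expressed through [S k.+2], the only one that occurs as a divisor, so [field]
     meets a single atom besides the x and y. *)
  have Sk2 : S k.+3 = S k.+2 - r k.+2 by rewrite [S k.+2]SE // addrC addKr.
  rewrite tailE b_odd /D (SE k.+1) // Sk2.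
  rewrite /theta2 /theta /r.
  by field; rewrite !x_neq0 !y_neq0 Sk1.
have odd_neq0 : b k.*2.+3 + cfrac a b k.+1.*2.+2 m.*2.+1 != 0.
  by rewrite oddE !(mulf_neq0, invr_neq0, expf_neq0).
have evenE : b k.*2.+2 + a k.*2.+3 /
    (b k.*2.+3 + cfrac a b k.+1.*2.+2 m.*2.+1) =
    x k * r k.+1 * S k.+1 / D k.
  rewrite oddE b_even a_odd.
  (* Adding back the term subtracted in [D k] is the only use of its definition here; the rest holds
     for any nonzero [d] in its place. *)
  have -> : x k * r k.+1 * S k.+1 / D k = x k * (1 + r k * S k.+2 / D k).
    by rewrite -[1](divff Dk) -mulrDl /D subrK !mulrA.
  move: (D k) Dk => d Dk; rewrite /theta2 /theta /r.
  by field; rewrite !x_neq0 !y_neq0 Sk1 Dk.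
have even_neq0 : x k * r k.+1 * S k.+1 / D k != 0.
  by rewrite !(mulf_neq0, invr_neq0).
rewrite doubleS; split.
  by split; [rewrite [cfrac _ _ _ _]/= evenE | split].
rewrite [LHS]/= -doubleS evenE a_even.
move: (D k) Dk => d Dk; rewrite /theta /r.
by field; rewrite !x_neq0 !y_neq0 Sk Dk.
Qed.

(** At k = 0 the tail is x_1 D_0 / S_1 = y_1 - x_1 + y_1 / S_1. Adding [b 1] leaves y_1 / S_1, which
    divides [a 1] to give S_1. *)
Lemma cfrac_sum : (0 < n)%N -> x 0 = 1 -> y 0 = 1 ->
    a 1 = y 1 -> b 1 = x 1 - y 1 ->
  cfrac_defined a b 1 n.*2 /\ \sum_(1 <= k < n.+1) y k / x k = cfrac a b 1 n.*2.
Proof.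
move=> n_gt0 x0 y0 a1 b1.
have [def_tail tailE] := @cfrac_even_tail n.-1 0 (prednK n_gt0).
have S1 : S 1 != 0 by apply: S_neq0.
have denE : b 1 + cfrac a b 2 n.-1.*2.+1 = y 1 / S 1.
  have S2 : S 2 = S 1 - r 1 by rewrite /S [in RHS]big_ltn // addrC addKr.
  rewrite tailE b1 /D S2 /r x0 y0.
  by field; rewrite x_neq0 S1 oner_neq0.
have -> : n.*2 = n.-1.*2.+2 by rewrite -doubleS prednK.
split; first by split=> //; rewrite denE mulf_neq0 ?invr_neq0.
rewrite -/(S 1) [RHS]/= -/(cfrac a b 2 n.-1.*2.+1) denE a1.
by rewrite invf_div mulrC divfK.
Qed.

End CfracTails.

(** * Nonvanishing by specialization to a field of characteristic 0 *)

Section Specialization.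
Variables (A : comNzRingType) (F : fieldType) (K : numFieldType).
Variables (iota : {rmorphism A -> F}) (ev : {rmorphism A -> K}).
Hypothesis iota_inj : injective iota.

(* [z] lies in the localization of A at the kernel of [ev], and [c] is its
   image under the extension of [ev] to that local ring. *)
Definition specializes (z : F) (c : K) :=
  exists p q, [/\ ev q != 0, z * iota q = iota p & ev p = c * ev q].

(** If [z] were 0, injectivity of [iota] would give [p = 0], hence [c * ev q = 0] with [ev q]
    nonzero. *)
Lemma specializes_neq0 z c : specializes z c -> c != 0 -> z != 0.
Proof.
case=> p [q [q0 zE pE]] c0; apply: contra_neq c0 => z0.
have p0 : p = 0 by apply: iota_inj; rewrite -zE z0 mul0r rmorph0.
by apply: (mulIf q0); rewrite -pE p0 mul0r rmorph0.
Qed.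

Lemma specializes_iota p : specializes (iota p) (ev p).
Proof. by exists p, 1; rewrite !rmorph1 !mulr1 oner_neq0. Qed.

Lemma specializes0 : specializes 0 0.
Proof. by have := specializes_iota 0; rewrite !rmorph0. Qed.

Lemma specializes1 : specializes 1 1.
Proof. by have := specializes_iota 1; rewrite !rmorph1. Qed.

Lemma specializesD z1 c1 z2 c2 :
  specializes z1 c1 -> specializes z2 c2 -> specializes (z1 + z2) (c1 + c2).
Proof.
case=> p1 [q1 [q10 z1E p1E]] [p2 [q2 [q20 z2E p2E]]].
exists (p1 * q2 + p2 * q1), (q1 * q2).
rewrite !rmorphD !rmorphM mulf_neq0 // -z1E -z2E p1E p2E.
by split=> //; ring.
Qed.

Lemma specializesN z c : specializes z c -> specializes (- z) (- c).
Proof.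
by case=> p [q [q0 zE pE]]; exists (- p), q; rewrite !rmorphN -zE pE !mulNr.
Qed.

Lemma specializesM z1 c1 z2 c2 :
  specializes z1 c1 -> specializes z2 c2 -> specializes (z1 * z2) (c1 * c2).
Proof.
case=> p1 [q1 [q10 z1E p1E]] [p2 [q2 [q20 z2E p2E]]].
exists (p1 * p2), (q1 * q2).
by rewrite !rmorphM mulf_neq0 // -z1E -z2E p1E p2E; split=> //; ring.
Qed.

Lemma specializesV z c : specializes z c -> c != 0 -> specializes z^-1 c^-1.
Proof.
move=> zc c0; have z0 := specializes_neq0 zc c0.
(* Numerator and denominator trade places: [ev p = c * ev q] is nonzero because [c] is. *)
case: zc => p [q [q0 zE pE]]; exists q, p.
by rewrite pE mulf_neq0 // -zE !mulKf.
Qed.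

Section OneSpecialization.
Variables (x y : nat -> F).
Hypotheses (x1 : forall k, specializes (x k) 1).
Hypotheses (y1 : forall k, specializes (y k) 1).

Lemma specializes_ratio k : specializes (y k / x k) 1.
Proof.
by rewrite -[1](divr1 1); apply: specializesM (specializesV _ (oner_neq0 _)).
Qed.

Lemma specializes_sum k n :
  specializes (\sum_(k <= j < n) y j / x j) (n - k)%:R.
Proof.
have -> : (n - k)%:R = \sum_(k <= j < n) 1 :> K.
  by rewrite big_const_nat iter_addr addr0.
apply: (big_ind2 specializes) => [|????|j _].
- exact: specializes0.
- exact: specializesD.
exact: specializes_ratio.
Qed.

Lemma x_neq0 k : x k != 0.
Proof. exact: specializes_neq0 (x1 k) (oner_neq0 _). Qed.

Lemma y_neq0 k : y k != 0.
Proof. exact: specializes_neq0 (y1 k) (oner_neq0 _). Qed.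

Lemma sum_neq0 k n : (k < n)%N -> \sum_(k <= j < n) y j / x j != 0.
Proof.
move=> lt_kn; apply: specializes_neq0 (specializes_sum k n) _.
by rewrite Num.Theory.pnatr_eq0 subn_eq0 -ltnNge.
Qed.

Lemma sum_det_neq0 k n : (k < n)%N ->
  y k.+1 / x k.+1 * (\sum_(k.+1 <= j < n.+1) y j / x j)
    - y k / x k * (\sum_(k.+2 <= j < n.+1) y j / x j) != 0.
Proof.
move=> lt_kn.
have spec :=
  specializesD (specializesM (specializes_ratio _) (specializes_sum _ _))
    (specializesN (specializesM (specializes_ratio _) (specializes_sum _ _))).
apply: specializes_neq0 (spec _ _ _ _ _ _) _.
(* As k < n, the truncated predecessor of n - k is a true one, and the value is (n - k) - (n - k -
   1) = 1. *)
rewrite !mul1r !subSS subnS -{1}(@prednK (n - k)) ?subn_gt0 //.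
by rewrite -natr1 addrC addKr oner_neq0.
Qed.

End OneSpecialization.
End Specialization.

(** * Evaluation at the point with all coordinates 1, and the theorem *)

Definition const1 (M : monomType) (m : M) : rat := 1.

Lemma const1_mmorphism (M : monomType) : mmorphism (@const1 M).
Proof. by split=> // m1 m2; rewrite /const1 mulr1. Qed.

HB.instance Definition _ (M : monomType) :=
  isMultiplicative.Build M rat (@const1 M) (const1_mmorphism M).

(** Each monomial has value 1 at that point, so evaluation there is the sum of the coefficients. *)
Definition eval1 : {rmorphism {malg rat[{cmonom (nat + nat)%type}]} -> rat} :=
  mmap idfun (@const1 _).

Lemma specializes_indet i : specializes (@tofrac _) eval1 (indet i) 1.
Proof.
have <- : eval1 << ucm i >> = 1 by rewrite [LHS]mmapU mul1r.
exact: specializes_iota.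
Qed.

Lemma specializes_x k : specializes (@tofrac _) eval1 (x k) 1.
Proof. by case: k => [|k]; [exact: specializes1 | exact: specializes_indet]. Qed.

Lemma specializes_y k : specializes (@tofrac _) eval1 (y k) 1.
Proof. by case: k => [|k]; [exact: specializes1 | exact: specializes_indet]. Qed.

Theorem theorem2 (n : nat) (a b : nat -> ratfun)
  (n_ge1 : (1 <= n)%N)
  (a1 : a 1%N = y 1)
  (b1 : b 1%N = x 1 - y 1)
  (a_even : forall k : nat, (1 <= k)%N -> a (2 * k)%N = theta y k.-1)
  (a_odd : forall k : nat, (1 <= k)%N -> a (2 * k + 1)%N = theta2 y k.-1)
  (b_even : forall k : nat, (1 <= k)%N -> b (2 * k)%N = x k.-1)
  (b_odd : forall k : nat, (1 <= k)%N ->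
     b (2 * k + 1)%N = (theta2 x k.-1 - theta2 y k.-1) / x k.-1) :
  cfrac_defined a b 1 (2 * n) /\
  \sum_(1 <= k < n.+1) y k / x k = cfrac a b 1 (2 * n).
Proof.
have tofracI : injective (@tofrac {malg rat[{cmonom (nat + nat)%type}]}).
  by move=> p q /eqP; rewrite tofrac_eq => /eqP.
have x0 := x_neq0 tofracI specializes_x.
have y0 := y_neq0 tofracI specializes_y.
(* Shifting k by one absorbs both the condition 1 <= k and the predecessors in the hypotheses. *)
have idx_even k : k.*2.+2 = (2 * k.+1)%N by rewrite mul2n.
have idx_odd k : k.*2.+3 = (2 * k.+1 + 1)%N by rewrite mul2n addn1.
have a_evenS k : a k.*2.+2 = theta y k by rewrite idx_even a_even.
have a_oddS k : a k.*2.+3 = theta2 y k by rewrite idx_odd a_odd.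
have b_evenS k : b k.*2.+2 = x k by rewrite idx_even b_even.
have b_oddS k : b k.*2.+3 = (theta2 x k - theta2 y k) / x k.
  by rewrite idx_odd b_odd.
have sum0 k (lt_kn : (k < n)%N) :=
  sum_neq0 tofracI specializes_x specializes_y (lt_kn : (k.+1 < n.+1)%N).
have det0 := sum_det_neq0 tofracI specializes_x specializes_y (n := n).
rewrite mul2n.
exact: (cfrac_sum x0 y0 a_evenS a_oddS b_evenS b_oddS sum0 det0 n_ge1
  (erefl _) (erefl _) a1 b1).
Qed.
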